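(* Assume that the strict three-wave resonance set $K^*$ is such that there exists a single triple wave number resonance $(n,k,m)$, modulo the symmetries $\sigma_j$, $j=1,2,3$, and that $\sigma_j(k)\neq k$, $\sigma_j(m)\neq m$, $\sigma_j(n)\neq n$ for $j=2$ and $j=3$. Then the strictly resonant Euler system reduces to three uncoupled rigid body systems in $\mathbf{C}^3$: the system $$\frac{dU_n}{dt}+i(\lambda_k-\lambda_m)C_{kmn}U_kU_m=0,$$ $$\frac{dU_k}{dt}-i(\lambda_m-\lambda_n)C_{kmn}U_nU_m^*=0,$$ $$\frac{dU_m}{dt}-i(\lambda_n-\lambda_k)C_{kmn}U_nU_k^*=0,$$ where $C_{kmn}=i\langle\mathbf{\Phi}_k\times\mathbf{\Phi}_m,\mathbf{\Phi}_n^*\rangle$ is real, and the other two uncoupled systems obtained with the symmetries $\sigma_2(k,m,n)$ and $\sigma_3(k,m,n)$. The energy and the helicity of each subsystem are conserved: $$\frac{d}{dt}\big(U_kU_k^*+U_mU_m^*+U_nU_n^*\big)=0,\qquad \frac{d}{dt}\big(\lambda_kU_kU_k^*+\lambda_mU_mU_m^*+\lambda_nU_nU_n^*\big)=0.$$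
   Context: Domain: the cylinder $\{y_1^2+y_2^2<1,\ 0<y_3<h\}$, periodic of period $h$ in $y_3$, with $\alpha=2\pi/h$. Curl eigenfunctions: divergence-free fields, tangent to the lateral boundary, $curl\,\mathbf{\Phi}_n=\lambda_n\mathbf{\Phi}_n$ ($\lambda_n$ a real, signed eigenvalue, $\pm|\lambda_n|$), of the form (in cylindrical coordinates) $(\Phi_{r,n}(r),\Phi_{\theta,n}(r),\Phi_{z,n}(r))e^{in_2\theta}e^{i\alpha n_3z}$, $n=(n_1,n_2,n_3)$, $n_2\in\mathbf{Z}$, $n_3\in\mathbf{Z}\setminus\{0\}$, $n_1$ indexing the radial eigenvalue problem. They satisfy $\mathbf{\Phi}(n_1,-n_2,-n_3)=\mathbf{\Phi}^*(n_1,n_2,n_3)$ and $\lambda(n_1,-n_2,-n_3)=\lambda(n_1,n_2,n_3)$, where $^*$ is complex conjugation. Since the curl eigenfunctions are even under $r\to-r$, $n_1\to-n_1$, indices are extended to negative $n_1$ by this symmetry; $-k$ then denotes the index of the conjugate mode of $k$. Strict three-wave resonance set: $K^*=\{(k,m,n):\ \pm\frac{k_3}{\lambda_k}\pm\frac{m_3}{\lambda_m}\pm\frac{n_3}{\lambda_n}=0,\ k_3m_3n_3\neq0,\ n_3=k_3+m_3,\ n_2=k_2+m_2\}$. Symmetries: $\sigma_1(n_1,n_2,n_3)=(-n_1,n_2,n_3)$, $\sigma_2(n_1,n_2,n_3)=(n_1,-n_2,n_3)$, $\sigma_3(n_1,n_2,n_3)=(n_1,n_2,-n_3)$; $\sigma_j(k,m,n)=(\sigma_jk,\sigma_jm,\sigma_jn)$.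 The set $K^*$ is invariant under each $\sigma_j$. Strictly resonant Euler system: for the amplitudes $\mathbf{u}_n(t)$, with $n_3\neq0$, $$\frac{d\mathbf{u}_n}{dt}+\sum_{(k,m,n)\in K^*}\lambda_k\langle\mathbf{\Phi}_k\times\mathbf{\Phi}_m,\mathbf{\Phi}_n\rangle\,\mathbf{u}_k\mathbf{u}_m=0,$$ where $\langle\cdot,\cdot\rangle$ is the $L^2$ complex inner product on the cylinder (second entry conjugated); in $C_{kmn}$ the conjugation is written explicitly, so $C_{kmn}=i\int(\mathbf{\Phi}_k\times\mathbf{\Phi}_m)\cdot\mathbf{\Phi}_n^*\,dy$. For real velocity fields the amplitudes satisfy $U_{-k}=U_k^*$, and similarly for $m$ and $n$. $U_k,U_m,U_n$ denote the complex amplitudes of the modes $k,m,n$, up to one overall sign $U=-\mathbf{u}$ common to all modes.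
   Formalization: The eigenfunctions are assumed phase-normalized (radial component imaginary, angular and axial components real), which a constant factor always achieves; for arbitrary phases the coefficient C_kmn need not be real and the stated systems fail. *)

(* Defs.v *)
From HB Require Import structures.
From mathcomp Require Import all_boot all_order all_algebra finmap.
From mathcomp Require Import complex.
From mathcomp Require Import all_classical all_reals all_analysis.

Set Implicit Arguments.
Unset Strict Implicit.
Unset Printing Implicit Defensive.

Import Order.TTheory GRing.Theory Num.Theory.
Import numFieldNormedType.Exports.

Local Open Scope classical_set_scope.
Local Open Scope ring_scope.
Local Open Scope complex_scope.

(** * Mode indices *)

(* An index is a triple (n_1, n_2, n_3); the group structure is componentwise,
   so that [- n] = (- n_1, - n_2, - n_3). *)
Definition wavenumber : Type := (int * int * int)%type.

Definition idx1 (n : wavenumber) : int := n.1.1.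
Definition idx2 (n : wavenumber) : int := n.1.2.
Definition idx3 (n : wavenumber) : int := n.2.

(* The radial index ranges over 1, 2, 3, ... and is extended to -1, -2, ...;
   modes with n_3 = 0 are excluded. *)
Definition admissible (n : wavenumber) : Prop := idx1 n != 0 /\ idx3 n != 0.

Definition sigma1 (n : wavenumber) : wavenumber := (- idx1 n, idx2 n, idx3 n).
Definition sigma2 (n : wavenumber) : wavenumber := (idx1 n, - idx2 n, idx3 n).
Definition sigma3 (n : wavenumber) : wavenumber := (idx1 n, idx2 n, - idx3 n).

(* The elements of the group generated by sigma1, sigma2, sigma3, which are
   commuting involutions. *)
Definition sigma (b1 b2 b3 : bool) (n : wavenumber) : wavenumber :=
  iter b1 sigma1 (iter b2 sigma2 (iter b3 sigma3 n)).

(* n and sigma1 n label the same eigenfunction; this is the label with a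
   nonnegative radial index. *)
Definition mode (n : wavenumber) : wavenumber := (`|idx1 n|, idx2 n, idx3 n).

(* (k, m, n) *)
Definition triad : Type := (wavenumber * wavenumber * wavenumber)%type.

Definition on_triad (f : wavenumber -> wavenumber) (T : triad) : triad :=
  (f T.1.1, f T.1.2, f T.2).

Definition modes (T : triad) : seq wavenumber :=
  [:: mode T.1.1; mode T.1.2; mode T.2].

(* The three wave vectors k, m, -n of a triad add up to zero in the second and
   third components.  Listing them forgets which of the three waves is written
   as the output: (k, m, n), (m, k, n), (n, -m, k), (-m, n, k), (n, -k, m) and
   (-k, n, m) have the same list up to permutation and overall sign. *)
Definition waves (T : triad) : seq wavenumber :=
  [:: mode T.1.1; mode T.1.2; mode (- T.2)].

(* T and T' are the same triple wave number resonance modulo the symmetries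
   (the overall sign is sigma true true true). *)
Definition same_resonance (T T' : triad) : Prop :=
  exists b1 b2 b3 : bool,
    perm_eq (waves (on_triad (sigma b1 b2 b3) T)) (waves T').

(** * Vector calculus for complex vector fields on R^3 *)

Section VectorCalculus.
Variable R : realType.

Definition point : Type := (R * R * R)%type.
Definition cvec : Type := 'rV[R[i]]_3.

Definition basis (j : 'I_3) : point :=
  ((j == 0)%:R, (j == 1)%:R, (j == 2%:R)%:R).

(* Indices in 'I_3 are added modulo 3. *)
Definition cross (u v : cvec) : cvec :=
  \row_(j < 3) (u 0 (j + 1) * v 0 (j + 2%:R) - u 0 (j + 2%:R) * v 0 (j + 1)).

(* bilinear, without conjugation *)
Definition dot (u v : cvec) : R[i] := \sum_(j < 3) u 0 j * v 0 j.

Definition conjv (u : cvec) : cvec := map_mx (@conjc R) u.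

Definition partial (j : 'I_3) (f : point -> R[i]) (y : point) : R[i] :=
  'D_(basis j) (fun x => complex.Re (f x)) y
  +i* 'D_(basis j) (fun x => complex.Im (f x)) y.

Definition curl (F : point -> cvec) (y : point) : cvec :=
  \row_(j < 3) (partial (j + 1) (fun x => F x 0 (j + 2%:R)) y
                - partial (j + 2%:R) (fun x => F x 0 (j + 1)) y).

Definition divergence (F : point -> cvec) (y : point) : R[i] :=
  \sum_(j < 3) partial j (fun x => F x 0 j) y.

(* The unbounded cylinders carry the h-periodic extensions; [cell h] is one
   period. *)
Definition cylinder : set point := [set y | y.1.1 ^+ 2 + y.1.2 ^+ 2 < 1].
Definition closed_cylinder : set point :=
  [set y | y.1.1 ^+ 2 + y.1.2 ^+ 2 <= 1].
Definition lateral_boundary : set point :=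
  [set y | y.1.1 ^+ 2 + y.1.2 ^+ 2 = 1].
Definition cell (h : R) : set point := cylinder `&` [set y | 0 < y.2 < h].

Definition volume :=
  ((@lebesgue_measure R \x @lebesgue_measure R) \x @lebesgue_measure R)%E.

Definition cintegral (D : set point) (f : point -> R[i]) : R[i] :=
  Rintegral volume D (fun y => complex.Re (f y))
  +i* Rintegral volume D (fun y => complex.Im (f y)).

Definition inner (h : R) (F G : point -> cvec) : R[i] :=
  cintegral (cell h) (fun y => dot (F y) (conjv (G y))).

Definition cis (x : R) : R[i] := cos x +i* sin x.

Definition e_r (theta : R) : cvec :=
  (cos theta)%:C *: delta_mx 0 0 + (sin theta)%:C *: delta_mx 0 1.
Definition e_theta (theta : R) : cvec :=
  (- sin theta)%:C *: delta_mx 0 0 + (cos theta)%:C *: delta_mx 0 1.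
Definition e_z : cvec := delta_mx 0 2%:R.

End VectorCalculus.

(** * Curl eigenfunctions *)

Section CurlModes.
Variable R : realType.

Record curl_modes (h : R) := CurlModes {
  lam : wavenumber -> R;
  Phi : wavenumber -> point R -> cvec R;
  Phi_r : wavenumber -> R -> R[i];
  Phi_theta : wavenumber -> R -> R[i];
  Phi_z : wavenumber -> R -> R[i];
  Phi_polar : forall n, admissible n -> forall r theta z : R, 0 <= r <= 1 ->
    Phi n (r * cos theta, r * sin theta, z) =
      (cis ((idx2 n)%:~R * theta) * cis (2 * pi / h * (idx3 n)%:~R * z)) *:
      (Phi_r n r *: e_r theta + Phi_theta n r *: e_theta theta
       + Phi_z n r *: e_z R);
  Phi_neq0 : forall n, admissible n ->
    exists2 y, cylinder y & Phi n y != 0;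
  Phi_differentiable : forall n, admissible n -> forall (j : 'I_3) y,
    cylinder y ->
    differentiable (fun x => complex.Re (Phi n x 0 j)) y /\
    differentiable (fun x => complex.Im (Phi n x 0 j)) y;
  Phi_continuous : forall n, admissible n -> forall j : 'I_3,
    {within @closed_cylinder R,
       continuous (fun x => complex.Re (Phi n x 0 j))} /\
    {within @closed_cylinder R,
       continuous (fun x => complex.Im (Phi n x 0 j))};
  Phi_div : forall n, admissible n -> forall y, cylinder y ->
    divergence (Phi n) y = 0;
  Phi_curl : forall n, admissible n -> forall y, cylinder y ->
    curl (Phi n) y = (lam n)%:C *: Phi n y;
  Phi_tangent : forall n, admissible n -> forall y, lateral_boundary y ->
    y.1.1%:C * Phi n y 0 0 + y.1.2%:C * Phi n y 0 1 = 0;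
  lam_neq0 : forall n, admissible n -> lam n != 0;
  Phi_sigma1 : forall n, admissible n -> forall y, closed_cylinder y ->
    Phi (sigma1 n) y = Phi n y;
  lam_sigma1 : forall n, admissible n -> lam (sigma1 n) = lam n;
  Phi_conj : forall n, admissible n -> forall y, closed_cylinder y ->
    Phi (idx1 n, - idx2 n, - idx3 n) y = conjv (Phi n y);
  lam_conj : forall n, admissible n ->
    lam (idx1 n, - idx2 n, - idx3 n) = lam n
}.

(* Writing Phi_r = i a, the equation curl Phi = lam Phi is a real linear system
   for (a, Phi_theta, Phi_z), so each eigenfunction is fixed up to a complex
   factor by a real solution.  This condition fixes the phase of that factor up
   to sign; for arbitrary phases the coefficients [coupling] below would be
   real only up to a unit complex factor. *)
Definition phase_normalized (h : R) (M : curl_modes h) : Prop :=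
  forall n, admissible n -> forall r : R, 0 <= r <= 1 ->
    [/\ complex.Re (Phi_r M n r) = 0, complex.Im (Phi_theta M n r) = 0
      & complex.Im (Phi_z M n r) = 0].

(** * Resonances *)

(* All choices of the three signs are allowed. *)
Definition Kstar (lam : wavenumber -> R) : set triad :=
  [set T | let: (k, m, n) := T in
    [/\ [/\ admissible k, admissible m & admissible n],
        exists s1 s2 s3 : bool,
          (-1) ^+ s1 * ((idx3 k)%:~R / lam k)
          + (-1) ^+ s2 * ((idx3 m)%:~R / lam m)
          + (-1) ^+ s3 * ((idx3 n)%:~R / lam n) = 0,
        idx3 k * idx3 m * idx3 n != 0,
        idx3 n = idx3 k + idx3 m &
        idx2 n = idx2 k + idx2 m]].

Definition sigma_invariant (K : set triad) : Prop :=
  forall T, K T ->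
    [/\ K (on_triad sigma1 T), K (on_triad sigma2 T) & K (on_triad sigma3 T)].

Definition single_resonance (K : set triad) (T : triad) : Prop :=
  K T /\ forall T', K T' -> same_resonance T T'.

(** * The strictly resonant Euler system *)

Definition is_cderive (f : R -> R[i]) (t : R) (v : R[i]) : Prop :=
  is_derive t 1 (fun s => complex.Re (f s)) (complex.Re v) /\
  is_derive t 1 (fun s => complex.Im (f s)) (complex.Im v).

(* unconditional summation of f over D *)
Definition has_sum (I : choiceType) (D : set I) (f : I -> R[i]) (S : R[i]) :
    Prop :=
  forall e : R, 0 < e ->
    exists2 A : {fset I}, [set` A] `<=` D &
      forall B : {fset I}, (A `<=` B)%fset -> [set` B] `<=` D ->
        `|\sum_(x <- B) f x - S| < e%:C.

(* Ordered pairs (k, m) with (k, m, n) in K, every mode being counted once,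
   i.e. with a positive radial index. *)
Definition inputs (K : set triad) (n : wavenumber) :
    set (wavenumber * wavenumber) :=
  [set p | [/\ K (p.1, p.2, n), 0 < idx1 p.1 & 0 < idx1 p.2]].

Definition resonant_euler (h : R) (M : curl_modes h) (J : set R)
    (u : wavenumber -> R -> R[i]) : Prop :=
  forall n, admissible n -> forall t, J t ->
    exists2 S : R[i],
      has_sum (inputs (Kstar (lam M)) n)
        (fun p => (lam M p.1)%:C
                  * inner h (fun y => cross (Phi M p.1 y) (Phi M p.2 y))
                      (Phi M n)
                  * (u p.1 t * u p.2 t)) S
      & is_cderive (u n) t (- S).

(* amplitudes of a real velocity field, on the extended index set *)
Definition real_amplitudes (J : set R) (u : wavenumber -> R -> R[i]) : Prop :=
  forall n, admissible n -> forall t, J t ->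
    u (sigma1 n) t = u n t /\ u (- n) t = (u n t)^*.

(** * Rigid body systems *)

(* C_kmn *)
Definition coupling (h : R) (M : curl_modes h) (T : triad) : R[i] :=
  'i * cintegral (cell h)
         (fun y => dot (cross (Phi M T.1.1 y) (Phi M T.1.2 y))
                       (conjv (Phi M T.2 y))).

Definition rigid_body (lk lm ln : R) (C : R[i]) (J : set R)
    (Uk Um Un : R -> R[i]) : Prop :=
  forall t, J t ->
    [/\ is_cderive Un t (- ('i * (lk - lm)%:C * C * Uk t * Um t)),
        is_cderive Uk t ('i * (lm - ln)%:C * C * Un t * (Um t)^*) &
        is_cderive Um t ('i * (ln - lk)%:C * C * Un t * (Uk t)^*)].

Definition rigid_body_of (h : R) (M : curl_modes h) (T : triad) (J : set R)
    (Uk Um Un : R -> R[i]) : Prop :=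
  rigid_body (lam M T.1.1) (lam M T.1.2) (lam M T.2) (coupling M T) J Uk Um Un.

(* The systems of T and T' have no mode in common, or both are trivial. *)
Definition uncoupled (h : R) (M : curl_modes h) (T T' : triad) : Prop :=
  ~~ has (mem (modes T)) (modes T') \/ coupling M T = 0 /\ coupling M T' = 0.

End CurlModes.

(* Main.v *)
Require Import Defs.
From HB Require Import structures.
From mathcomp Require Import all_boot all_order all_algebra finmap.
From mathcomp Require Import complex.
From mathcomp Require Import all_classical all_reals all_analysis.
From mathcomp Require Import ring zify.

Set Implicit Arguments.
Unset Strict Implicit.
Unset Printing Implicit Defensive.

Import Order.TTheory GRing.Theory Num.Theory.
Import numFieldNormedType.Exports.

Local Open Scope classical_set_scope.
Local Open Scope ring_scope.
Local Open Scope complex_scope.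

(* Writing the output mode of a triad as minus a third wave makes the resonance
   conditions symmetric in three waves x, y, z of sum zero.  The integral of
   det (Phi_x, Phi_y, Phi_z) is alternating, and it is purely imaginary because
   in cylindrical components the phase normalisation makes one column imaginary
   and two real.  Hence the mode - z receives exactly the two contributions
   (x, y) and (y, x), which add up to (lam_x - lam_y) D(x, y, z) U_x U_y, and the
   three cyclic permutations give the rigid body system.  A wave belongs to only
   one of the four images of the triad under sigma2, sigma3: equal flips of two
   waves would make a component of the third vanish.  The fourth image, under
   sigma2 sigma3, carries the conjugate of the original system. *)

(** * Integrals of complex-valued functions *)

Lemma complex_eq (R : realType) (x y : R[i]) :
  complex.Re x = complex.Re y -> complex.Im x = complex.Im y -> x = y.
Proof. by case: x y => [a b] [c d] /= -> ->. Qed.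

(* [fine] sends every infinite value of the integral, [+oo - +oo] included,
   to 0, so the identity holds even when the integral of f is undefined. *)
Lemma RintegralN (R : realType) (d : measure_display) (T : measurableType d)
    (mu : {measure set T -> \bar R}) (D : set T) (f : T -> R) :
  Rintegral mu D (fun x => - f x) = - Rintegral mu D f.
Proof.
rewrite /Rintegral.
have -> : (fun x => (- f x)%:E) = (\- (fun x => (f x)%:E))%E by [].
rewrite integralE [in RHS]integralE funeposN funenegN.
by case: (integral _ _ _) => [a||]; case: (integral _ _ _) => [b||] //=;
  rewrite ?oppr0 ?opprB.
Qed.

Lemma Rintegral_eq0 (R : realType) (d : measure_display) (T : measurableType d)
    (mu : {measure set T -> \bar R}) (D : set T) (f : T -> R) :
  (forall x, D x -> f x = 0) -> Rintegral mu D f = 0.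
Proof.
move=> f0; rewrite /Rintegral (eq_integral (cst 0%E)); last first.
  by move=> x /set_mem /f0 ->.
by rewrite integral0.
Qed.

Lemma eq_cintegral (R : realType) (D : set (Defs.point R)) (f g : Defs.point R -> R[i]) :
  (forall y, D y -> f y = g y) -> cintegral D f = cintegral D g.
Proof.
by move=> fg; congr (_ +i* _); apply: eq_Rintegral => y /set_mem /fg ->.
Qed.

Lemma ReN (R : realType) (x : R[i]) : complex.Re (- x) = - complex.Re x.
Proof. by case: x. Qed.

Lemma ImN (R : realType) (x : R[i]) : complex.Im (- x) = - complex.Im x.
Proof. by case: x. Qed.

Lemma cintegralN (R : realType) (D : set (Defs.point R)) (f : Defs.point R -> R[i]) :
  cintegral D (fun y => - f y) = - cintegral D f.
Proof.
rewrite /cintegral; apply: complex_eq; rewrite ?ReN ?ImN /= -RintegralN.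
  by apply: eq_Rintegral => y _; rewrite ReN.
by apply: eq_Rintegral => y _; rewrite ImN.
Qed.

Lemma cintegral_conj (R : realType) (D : set (Defs.point R)) (f : Defs.point R -> R[i]) :
  cintegral D (fun y => (f y)^*) = (cintegral D f)^*.
Proof.
rewrite /cintegral; apply: complex_eq => /=; first by
  apply: eq_Rintegral => y _; case: (f y).
by rewrite -RintegralN; apply: eq_Rintegral => y _; case: (f y).
Qed.

(** * Scalar triple products and polar coordinates *)

Lemma dot_crossE (R : realType) (u v w : cvec R) :
  dot (cross u v) w =
    (u 0 1 * v 0 2%:R - u 0 2%:R * v 0 1) * w 0 0
    + (u 0 2%:R * v 0 0 - u 0 0 * v 0 2%:R) * w 0 1
    + (u 0 0 * v 0 1 - u 0 1 * v 0 0) * w 0 2%:R.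
Proof.
rewrite /dot /cross !big_ord_recl big_ord0 !mxE addr0 addrA.
by do !congr (_ + _); do ?congr (_ * _); do ?congr (_ - _); do ?congr (_ * _);
  congr (_ 0 _); apply/val_inj.
Qed.

Lemma dot_cross_cyclic (R : realType) (u v w : cvec R) :
  dot (cross v w) u = dot (cross u v) w.
Proof. by rewrite !dot_crossE; ring. Qed.

Lemma dot_cross_swap (R : realType) (u v w : cvec R) :
  dot (cross v u) w = - dot (cross u v) w.
Proof. by rewrite !dot_crossE; ring. Qed.

Lemma dot_cross_conj (R : realType) (u v w : cvec R) :
  dot (cross (conjv u) (conjv v)) (conjv w) = (dot (cross u v) w)^*.
Proof.
rewrite !dot_crossE !mxE.
case: (u 0 0) (u 0 1) (u 0 2%:R) => [? ?] [? ?] [? ?].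
case: (v 0 0) (v 0 1) (v 0 2%:R) => [? ?] [? ?] [? ?].
case: (w 0 0) (w 0 1) (w 0 2%:R) => [? ?] [? ?] [? ?].
by apply: complex_eq => /=; ring.
Qed.

Lemma dot_cross_scale (R : realType) (a b c : R[i]) (u v w : cvec R) :
  dot (cross (a *: u) (b *: v)) (c *: w) = a * b * c * dot (cross u v) w.
Proof. by rewrite !dot_crossE !mxE; ring. Qed.

Lemma cisD (R : realType) (x y : R) : cis x * cis y = cis (x + y).
Proof. by rewrite /cis cosD sinD; apply: complex_eq => /=; ring. Qed.

(** The angle is plus or minus [acos (x / r)] according to the sign of [y], because the sine of
    [acos] only recovers the absolute value of [y]; the origin gets angle 0. *)
Lemma polar_coordinates (R : realType) (x y : R) :
  exists r theta : R,
    [/\ 0 <= r, r ^+ 2 = x ^+ 2 + y ^+ 2, x = r * cos theta &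
        y = r * sin theta].
Proof.
set r := Num.sqrt (x ^+ 2 + y ^+ 2).
have r2 : r ^+ 2 = x ^+ 2 + y ^+ 2 by rewrite sqr_sqrtr// addr_ge0 ?sqr_ge0.
have r_ge0 : 0 <= r := sqrtr_ge0 _.
have [r0|r_neq0] := eqVneq r 0.
  exists 0, 0; move: r2; rewrite r0 expr0n /= => /esym/eqP.
  rewrite paddr_eq0 ?sqr_ge0 // !sqrf_eq0 => /andP[/eqP -> /eqP ->].
  by rewrite !mul0r expr0n addr0.
have r_gt0 : 0 < r by rewrite lt_neqAle eq_sym r_neq0.
have xr : -1 <= x / r <= 1.
  by rewrite -ler_norml normrM normfV (gtr0_norm r_gt0) ler_pdivrMr // mul1r
    -(@ler_pXn2r _ 2) ?nnegrE // real_normK ?num_real // r2 lerDl sqr_ge0.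
have cosE : r * cos (acos (x / r)) = x.
  by rewrite acosK ?in_itv //= mulrC divfK.
have sinE : r * sin (acos (x / r)) = `|y|.
  rewrite sin_acos //.
  have -> : 1 - (x / r) ^+ 2 = y ^+ 2 / r ^+ 2.
    by rewrite expr_div_n; apply: canRL (mulfK _) _; rewrite ?sqrf_eq0 //
      mulrBl mul1r divfK ?sqrf_eq0 // r2 addrAC subrr add0r.
  by rewrite sqrtrM ?sqr_ge0 // sqrtrV ?sqr_ge0 // !sqrtr_sqr (ger0_norm r_ge0)
    mulrC divfK.
have [y_ge0|y_lt0] := leP 0 y.
  by exists r, (acos (x / r)); rewrite cosE sinE ger0_norm.
exists r, (- acos (x / r)); rewrite cosN sinN mulrN cosE sinE ltr0_norm //.
by rewrite opprK.
Qed.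

(** * Relabelling and conjugation of modes *)

Lemma lam_mode (R : realType) (h : R) (M : curl_modes h) (x : wavenumber) :
  admissible x -> lam M (mode x) = lam M x.
Proof.
case: x => [[x1 x2] x3] ax; rewrite /mode /=.
by case: (ger0P (idx1 (x1, x2, x3))) => _ //; rewrite -[RHS]lam_sigma1.
Qed.

(** Negation reverses all three indices, conjugation only the last two; [sigma1] accounts for the
    difference, here and in [Phi_opp]. *)
Lemma lam_opp (R : realType) (h : R) (M : curl_modes h) (x : wavenumber) :
  admissible x -> lam M (- x) = lam M x.
Proof.
move=> ax; rewrite -[RHS]lam_conj // -[RHS]lam_sigma1 //.
by move: ax; rewrite /admissible /= !oppr_eq0.
Qed.

Lemma Phi_mode (R : realType) (h : R) (M : curl_modes h) (x : wavenumber)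
    (y : Defs.point R) :
  admissible x -> closed_cylinder y -> Phi M (mode x) y = Phi M x y.
Proof.
case: x => [[x1 x2] x3] ax hy; rewrite /mode /=.
by case: (ger0P (idx1 (x1, x2, x3))) => _ //; rewrite -[RHS]Phi_sigma1.
Qed.

Lemma Phi_opp (R : realType) (h : R) (M : curl_modes h) (x : wavenumber)
    (y : Defs.point R) :
  admissible x -> closed_cylinder y -> Phi M (- x) y = conjv (Phi M x y).
Proof.
move=> ax hy; rewrite -Phi_conj // -[RHS]Phi_sigma1 //.
by move: ax; rewrite /admissible /= !oppr_eq0.
Qed.

(** * The triple integral and its phase *)

Lemma cell_closed (R : realType) (h : R) (y : Defs.point R) :
  cell h y -> closed_cylinder y.
Proof. by case=> /ltW. Qed.

(** No entry is conjugated, unlike in [inner] and [coupling], so that the integral is alternating in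
    the three waves; the conjugate of the output is expressed by the opposite index. *)
Definition triple_int (R : realType) (h : R) (M : curl_modes h)
    (x y z : wavenumber) : R[i] :=
  cintegral (cell h) (fun p => dot (cross (Phi M x p) (Phi M y p)) (Phi M z p)).

Lemma triple_int_cyclic (R : realType) (h : R) (M : curl_modes h)
    (x y z : wavenumber) : triple_int M y z x = triple_int M x y z.
Proof. by apply: eq_cintegral => p _; rewrite dot_cross_cyclic. Qed.

Lemma triple_int_swap (R : realType) (h : R) (M : curl_modes h)
    (x y z : wavenumber) : triple_int M y x z = - triple_int M x y z.
Proof.
by rewrite -cintegralN; apply: eq_cintegral => p _; rewrite dot_cross_swap.
Qed.

Lemma triple_int_diag (R : realType) (h : R) (M : curl_modes h)
    (x z : wavenumber) : triple_int M x x z = 0.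
Proof.
by apply/eqP; rewrite -eqNr -triple_int_swap.
Qed.

Lemma triple_int_mode (R : realType) (h : R) (M : curl_modes h)
    (x y z : wavenumber) :
  admissible x -> admissible y -> admissible z ->
  triple_int M (mode x) (mode y) (mode z) = triple_int M x y z.
Proof.
move=> ax ay az; apply: eq_cintegral => p /cell_closed hp.
by rewrite !Phi_mode.
Qed.

Lemma triple_int_opp (R : realType) (h : R) (M : curl_modes h)
    (x y z : wavenumber) :
  admissible x -> admissible y -> admissible z ->
  triple_int M (- x) (- y) (- z) = (triple_int M x y z)^*.
Proof.
move=> ax ay az; rewrite -cintegral_conj.
apply: eq_cintegral => p /cell_closed hp.
by rewrite !Phi_opp // dot_cross_conj.
Qed.

Lemma frameE (R : realType) (theta : R) (a b c : R[i]) :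
  let v := a *: e_r theta + b *: e_theta theta + c *: e_z R in
  [/\ v 0 0 = a * (cos theta)%:C - b * (sin theta)%:C,
      v 0 1 = a * (sin theta)%:C + b * (cos theta)%:C & v 0 2%:R = c].
Proof.
have e01 : (0 == 1 :> 'I_3) = false by [].
have e02 : (0 == 2%:R :> 'I_3) = false by [].
have e10 : (1 == 0 :> 'I_3) = false by [].
have e12 : (1 == 2%:R :> 'I_3) = false by [].
have e20 : (2%:R == 0 :> 'I_3) = false by [].
have e21 : (2%:R == 1 :> 'I_3) = false by [].
by split; rewrite !mxE !eqxx ?(e01, e02, e10, e12, e20, e21)
  !(mulr0, mulr1, addr0, add0r) // rmorphN mulrN.
Qed.

(* In the frame (e_r, e_theta, e_z) the integrand is a 3x3 determinant with one
   imaginary column and two real ones. *)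
Lemma Re_frame_det (R : realType) (theta : R) (a1 b1 c1 a2 b2 c2 a3 b3 c3 : R[i]) :
  complex.Re a1 = 0 -> complex.Im b1 = 0 -> complex.Im c1 = 0 ->
  complex.Re a2 = 0 -> complex.Im b2 = 0 -> complex.Im c2 = 0 ->
  complex.Re a3 = 0 -> complex.Im b3 = 0 -> complex.Im c3 = 0 ->
  complex.Re (dot (cross (a1 *: e_r theta + b1 *: e_theta theta + c1 *: e_z R)
                         (a2 *: e_r theta + b2 *: e_theta theta + c2 *: e_z R))
                  (a3 *: e_r theta + b3 *: e_theta theta + c3 *: e_z R)) = 0.
Proof.
rewrite dot_crossE.
have [-> -> ->] := frameE theta a1 b1 c1.
have [-> -> ->] := frameE theta a2 b2 c2.
have [-> -> ->] := frameE theta a3 b3 c3.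
case: a1 b1 c1 a2 b2 c2 => [? ?] [? ?] [? ?] [? ?] [? ?] [? ?].
case: a3 b3 c3 => [? ?] [? ?] [? ?] /=; do 9!move=> ->.
ring.
Qed.

(** The angular and axial phases multiply to 1 because the indices sum to zero. What remains is the
    determinant of the radial profiles, whose real part vanishes at every point. *)
Lemma Re_triple_int (R : realType) (h : R) (M : curl_modes h)
    (x y z : wavenumber) :
  phase_normalized M -> admissible x -> admissible y -> admissible z ->
  idx2 x + idx2 y + idx2 z = 0 -> idx3 x + idx3 y + idx3 z = 0 ->
  complex.Re (triple_int M x y z) = 0.
Proof.
move=> MP ax ay az e2 e3; apply: Rintegral_eq0 => -[[p1 p2] p3].
move=> /cell_closed; rewrite /closed_cylinder /= => p_le1.
have [r [theta [r_ge0 r2 p1E p2E]]] := polar_coordinates p1 p2.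
have r01 : 0 <= r <= 1.
  by rewrite r_ge0 -(@ler_pXn2r _ 2) ?nnegrE // r2 expr1n.
rewrite p1E p2E !Phi_polar // dot_cross_scale.
set E := (X in X * _).
have -> : E = 1.
  rewrite (_ : E = cis ((idx2 x + idx2 y + idx2 z)%:~R * theta)
      * cis (2 * pi / h * (idx3 x + idx3 y + idx3 z)%:~R * p3)).
    by rewrite e2 e3 mulr0z mulr0 !mul0r /cis cos0 sin0 mulr1.
  rewrite {}/E; move: (2 * pi / h) => alpha.
  by rewrite !intrD !mulrDr !mulrDl -!cisD; ring.
rewrite mul1r; have [xr xt xz] := MP x ax r r01.
have [yr yt yz] := MP y ay r r01; have [zr zt zz] := MP z az r r01.
exact: Re_frame_det.
Qed.

(** * Sign flips acting on modes *)

Notation flip := (sigma false).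

Lemma sigmaE (b1 b2 b3 : bool) (x : wavenumber) :
  sigma b1 b2 b3 x = ((-1) ^+ b1 * idx1 x, (-1) ^+ b2 * idx2 x, (-1) ^+ b3 * idx3 x).
Proof.
by case: x => [[x1 x2] x3]; case: b1 b2 b3 => [] [] [];
  rewrite /sigma /= /sigma1 /sigma2 /sigma3 /= ?expr1 ?expr0 ?mul1r ?mulN1r.
Qed.

Lemma flipK (b2 b3 : bool) : involutive (flip b2 b3).
Proof. by case=> [[x1 x2] x3]; rewrite !sigmaE /= !mulrA -!signr_addb !addbb !mul1r. Qed.

Lemma flipM (b2 b3 c2 c3 : bool) (x : wavenumber) :
  flip b2 b3 (flip c2 c3 x) = flip (b2 (+) c2) (b3 (+) c3) x.
Proof. by case: x => [[x1 x2] x3]; rewrite !sigmaE /= !mulrA -!signr_addb. Qed.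

(** The absolute value in [mode] absorbs [sigma1], so only the four flips of the last two indices
    act on modes. *)
Lemma mode_sigma (b1 b2 b3 : bool) (x : wavenumber) :
  mode (sigma b1 b2 b3 x) = flip b2 b3 (mode x).
Proof.
by case: x => [[x1 x2] x3]; rewrite !sigmaE /mode /= normrM normrX normrN1
  expr1n mul1r.
Qed.

Lemma mode_opp (x : wavenumber) : mode (- x) = flip true true (mode x).
Proof. by case: x => [[x1 x2] x3]; rewrite sigmaE /mode /= normrN !mulN1r mul1r. Qed.

Lemma sigma_opp (b1 b2 b3 : bool) (x : wavenumber) :
  sigma b1 b2 b3 (- x) = - sigma b1 b2 b3 x.
Proof. by case: x => [[x1 x2] x3]; rewrite !sigmaE /= !mulrN. Qed.

Lemma mode_pos (x : wavenumber) : 0 < idx1 x -> mode x = x.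
Proof. by case: x => [[x1 x2] x3] /= x_gt0; rewrite /mode /= gtr0_norm. Qed.

Lemma mode_id (x : wavenumber) : mode (mode x) = mode x.
Proof. by rewrite /mode /= normr_id. Qed.

Lemma admissible_mode (x : wavenumber) : admissible (mode x) <-> admissible x.
Proof. by rewrite /admissible /= normr_eq0. Qed.

Lemma admissible_opp (x : wavenumber) : admissible (- x) <-> admissible x.
Proof. by rewrite /admissible /= !oppr_eq0. Qed.

Lemma waves_sigma (b1 b2 b3 : bool) (T : triad) :
  waves (on_triad (sigma b1 b2 b3) T) = map (flip b2 b3) (waves T).
Proof. by rewrite /waves /= -!sigma_opp !mode_sigma. Qed.

Lemma modes_sigma (b1 b2 b3 : bool) (T : triad) :
  modes (on_triad (sigma b1 b2 b3) T) = map (flip b2 b3) (modes T).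
Proof. by rewrite /modes /= !mode_sigma. Qed.

(* If flips of two of the three waves coincide, the second (or third) components
   of these waves agree up to sign; opposite signs would make the component of
   the remaining wave vanish. *)
Lemma flip_orbit_disjoint (x y z v : wavenumber) (b2 b3 c2 c3 : bool) :
  [/\ idx2 x != 0, idx2 y != 0 & idx2 z != 0] ->
  [/\ idx3 x != 0, idx3 y != 0 & idx3 z != 0] ->
  idx2 x + idx2 y + idx2 z = 0 -> idx3 x + idx3 y + idx3 z = 0 ->
  v \in map (flip b2 b3) [:: x; y; z] ->
  v \in map (flip c2 c3) [:: x; y; z] ->
  b2 = c2 /\ b3 = c3.
Proof.
case: x y z v => [[x1 x2] x3] [[y1 y2] y3] [[z1 z2] z3] [[v1 v2] v3] /=.
move=> [/eqP x2n /eqP y2n /eqP z2n] [/eqP x3n /eqP y3n /eqP z3n] s2 s3.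
rewrite !inE !sigmaE /= !xpair_eqE.
rewrite !mul1r => /or3P[] /andP[/andP[_ /eqP e2] /eqP e3] /or3P[]
  /andP[/andP[_ /eqP f2] /eqP f3].
all: split; [move: e2 f2; case: b2; case: c2|move: e3 f3; case: b3; case: c3].
all: by rewrite /= ?expr0 ?expr1 ?mul1r ?mulN1r; lia.
Qed.

(** * Resonance conditions symmetrised in the three waves *)

Lemma perm_eq2 (A : eqType) (x y x' y' : A) :
  perm_eq [:: x; y] [:: x'; y'] -> (x, y) = (x', y') \/ (x, y) = (y', x').
Proof.
move=> pe; have : x \in [:: x'; y'] by rewrite -(perm_mem pe) mem_head.
rewrite !inE => /orP[] /eqP e; move: pe; rewrite {}e.
  by rewrite perm_cons => /perm_mem/(_ y); rewrite !inE eqxx => /esym/eqP ->; left.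
rewrite perm_sym -(perm_rot 1 [:: x'; y']) /= perm_cons.
by move=> /perm_mem/(_ x'); rewrite !inE eqxx => /esym/eqP ->; right.
Qed.

(** A transposition and a 3-cycle generate all permutations of three entries. *)
Lemma perm_eq3_ind (A : eqType) (P : A -> A -> A -> Prop) (x y z x' y' z' : A) :
  (forall a b c, P a b c -> P b a c) -> (forall a b c, P a b c -> P b c a) ->
  perm_eq [:: x; y; z] [:: x'; y'; z'] -> P x y z -> P x' y' z'.
Proof.
move=> Pswap Prot.
wlog -> : x y z / x' = x.
  move=> H pe; have : x' \in [:: x; y; z] by rewrite (perm_mem pe) mem_head.
  rewrite !inE => /or3P[] /eqP e Pxyz; first exact: (H x y z).
    apply: (H y z x) => //; last exact: Prot.
    by rewrite -(perm_rot 1 [:: x; y; z]) in pe.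
  apply: (H z x y) => //; last exact/Prot/Prot.
  by rewrite -(perm_rot 2 [:: x; y; z]) in pe.
rewrite perm_cons => pe; case/perm_eq2: pe => [[-> ->]|[-> ->]] //.
by move=> /Pswap/Prot.
Qed.

(* The conditions defining [Kstar], symmetrised in the three waves x, y, z,
   where - z is the output mode. *)
Definition resonant_waves (R : realType) (lam : wavenumber -> R)
    (x y z : wavenumber) : Prop :=
  [/\ [/\ admissible x, admissible y & admissible z],
      exists s1 s2 s3 : bool,
        (-1) ^+ s1 * ((idx3 x)%:~R / lam x)
        + (-1) ^+ s2 * ((idx3 y)%:~R / lam y)
        + (-1) ^+ s3 * ((idx3 z)%:~R / lam z) = 0,
      idx2 x + idx2 y + idx2 z = 0 &
      idx3 x + idx3 y + idx3 z = 0].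

Lemma resonant_waves_swap (R : realType) (lam : wavenumber -> R)
    (x y z : wavenumber) :
  resonant_waves lam x y z -> resonant_waves lam y x z.
Proof.
case=> [[ax ay az] [s1 [s2 [s3 s0]]] e2 e3]; split=> //; last 2 first.
- by rewrite addrC (addrC (idx2 y)) addrC.
- by rewrite addrC (addrC (idx3 y)) addrC.
by exists s2, s1, s3; rewrite -[RHS]s0; congr (_ + _); rewrite addrC.
Qed.

Lemma resonant_waves_rot (R : realType) (lam : wavenumber -> R)
    (x y z : wavenumber) :
  resonant_waves lam x y z -> resonant_waves lam y z x.
Proof.
case=> [[ax ay az] [s1 [s2 [s3 s0]]] e2 e3]; split=> //; last 2 first.
- by rewrite addrC addrA.
- by rewrite addrC addrA.
by exists s2, s3, s1; rewrite addrC addrA.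
Qed.

(** With the output moved to the other side, the selection rules become zero sums; [lam] is
    unchanged by [mode] and negation, and admissibility supplies the nonvanishing product. *)
Lemma Kstar_waves (R : realType) (h : R) (M : curl_modes h)
    (x y n : wavenumber) :
  Kstar (lam M) (x, y, n) <-> resonant_waves (lam M) (mode x) (mode y) (mode (- n)).
Proof.
split.
  case=> [[ax ay an] [s1 [s2 [s3 s0]]] _ e3 e2].
  split.
  - by split; apply/admissible_mode => //; apply/admissible_opp.
  (* The third index of [- n] has the opposite sign, so the third sign is toggled to keep the
     sum. *)
  - exists s1, s2, (~~ s3); rewrite !lam_mode ?lam_opp //; last first.
      exact/admissible_opp.
    rewrite -[RHS]s0 signrN /=; congr (_ + _).
    by rewrite intrN !mulNr mulrN opprK.
  - by rewrite /= -e2 subrr.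
  - by rewrite /= -e3 subrr.
case=> [[/admissible_mode ax /admissible_mode ay /admissible_mode]].
move=> /admissible_opp an [s1 [s2 [s3 s0]]] e2 e3.
have e2' : idx2 n = idx2 x + idx2 y by apply/esym/eqP; rewrite -subr_eq0; apply/eqP.
have e3' : idx3 n = idx3 x + idx3 y by apply/esym/eqP; rewrite -subr_eq0; apply/eqP.
split=> //.
  exists s1, s2, (~~ s3); rewrite -[RHS]s0 !lam_mode ?lam_opp //.
    by rewrite signrN /= intrN !mulNr mulrN.
  exact/admissible_opp.
by case: ax ay an => _ ? [_ ?] [_ ?]; rewrite !mulf_neq0.
Qed.

(** The symmetrised conditions do not single out an output, so any of the three waves can take that
    place. *)
Lemma Kstar_perm (R : realType) (h : R) (M : curl_modes h) (T T' : triad) :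
  perm_eq (waves T) (waves T') -> Kstar (lam M) T -> Kstar (lam M) T'.
Proof.
case: T T' => [[x y] n] [[x' y'] n'] pe /Kstar_waves Kw; apply/Kstar_waves.
apply: (perm_eq3_ind _ _ pe Kw) => a b c.
  exact: resonant_waves_swap.
exact: resonant_waves_rot.
Qed.

Lemma sigma_invariant_sigma (K : set triad) (b1 b2 b3 : bool) (T : triad) :
  sigma_invariant K -> K T -> K (on_triad (sigma b1 b2 b3) T).
Proof.
move=> KI KT.
have step (f : triad -> triad) (b : bool) (T' : triad) :
    (forall T0, K T0 -> K (f T0)) -> K T' -> K (iter b f T').
  by move=> Kf; case: b => //=; apply: Kf.
have -> : on_triad (sigma b1 b2 b3) T = iter b1 (on_triad sigma1)
    (iter b2 (on_triad sigma2) (iter b3 (on_triad sigma3) T)).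
  by case: T {KT} => [[x y] z]; case: b1 b2 b3 => [] [] [].
by do 3!(apply: (step _ _ _ _ _); first by move=> T0 /KI[]).
Qed.

(** * Derivatives of complex-valued functions and unconditional sums *)

Lemma is_cderive_eq_on (R : realType) (J : set R) (f g : R -> R[i]) (t : R)
    (v : R[i]) :
  open J -> J t -> (forall s, J s -> f s = g s) ->
  is_cderive f t v -> is_cderive g t v.
Proof.
move=> oJ Jt fg [dr di].
(* Openness of [J] turns equality on [J] into equality near [t]. *)
have fg_near : \near t, f t = g t.
  by move: (open_nbhs_nbhs (conj oJ Jt)); apply: filterS => s /fg.
by split; [apply: near_eq_is_derive dr|apply: near_eq_is_derive di];
  move: fg_near; apply: filterS => s ->.
Qed.

Lemma is_cderiveN (R : realType) (f : R -> R[i]) (t : R) (v : R[i]) :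
  is_cderive f t v -> is_cderive (fun s => - f s) t (- v).
Proof.
move=> [dr di]; split.
  rewrite ReN (_ : (fun s => complex.Re (- f s)) = - (fun s => complex.Re (f s))).
    exact: is_deriveN.
  by apply/funext => s; rewrite ReN.
rewrite ImN (_ : (fun s => complex.Im (- f s)) = - (fun s => complex.Im (f s))).
  exact: is_deriveN.
by apply/funext => s; rewrite ImN.
Qed.

Lemma is_cderive_conj (R : realType) (f : R -> R[i]) (t : R) (v : R[i]) :
  is_cderive f t v -> is_cderive (fun s => (f s)^*) t v^*.
Proof.
move=> [dr di]; split.
  rewrite (_ : complex.Re v^* = complex.Re v); last by case: v {dr di}.
  rewrite (_ : (fun s => complex.Re (f s)^*) = (fun s => complex.Re (f s))) //.
  by apply/funext => s; case: (f s).
rewrite (_ : complex.Im v^* = - complex.Im v); last by case: v {dr di}.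
rewrite (_ : (fun s => complex.Im (f s)^*) = - (fun s => complex.Im (f s))).
  exact: is_deriveN.
by apply/funext => s; rewrite /= [RHS]/(- _); case: (f s).
Qed.

Lemma is_cderive_conj_on (R : realType) (J : set R) (f g : R -> R[i]) (t : R)
    (v : R[i]) :
  open J -> J t -> (forall s, J s -> g s = (f s)^*) ->
  is_cderive f t v <-> is_cderive g t v^*.
Proof.
move=> oJ Jt gf; split=> [/is_cderive_conj df|/is_cderive_conj dg].
  by apply: is_cderive_eq_on oJ Jt _ df => s /gf.
by rewrite -(conjcK v); apply: is_cderive_eq_on oJ Jt _ dg => s /gf ->;
  rewrite conjcK.
Qed.

(** A finite index set is its own largest finite subset, so every approximation can be tested on the
    sum over all of [A]. *)
Lemma has_sum_fset (R : realType) (I : choiceType) (A : {fset I})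
    (f : I -> R[i]) (S : R[i]) :
  has_sum [set` A] f S <-> S = \sum_(x <- A) f x.
Proof.
split=> [fS|->]; last first.
  move=> e e_gt0; exists A => // B AB BA.
  have -> : B = A by apply/eqP; rewrite eqEfsubset AB andbT; apply/fsubsetP.
  by rewrite subrr normr0 ltcR.
apply/eqP; rewrite eq_sym -subr_eq0 -normr_eq0; apply: contraT => d_neq0.
set d := `|_| in d_neq0.
(* A complex norm is real, so the distance [d] itself can serve as tolerance, which gives
   [d < d]. *)
have dE : d = (complex.Re d)%:C.
  by rewrite /d; case: (_ - _) => a b.
have d_gt0 : 0 < complex.Re d.
  by rewrite -ltcR -dE lt_neqAle eq_sym d_neq0 normr_ge0.
have [B BA fB] := fS _ d_gt0.
have := fB A _ (@subset_refl _ _); rewrite -dE ltxx; apply.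
by apply/fsubsetP.
Qed.

(** * Resonant inputs of a given output mode *)

Lemma inner_cross (R : realType) (h : R) (M : curl_modes h)
    (x y a : wavenumber) :
  admissible a ->
  inner h (fun p => cross (Phi M x p) (Phi M y p)) (Phi M a)
  = triple_int M x y (mode (- a)).
Proof.
move=> aa; apply: eq_cintegral => p /cell_closed hp.
by rewrite Phi_mode ?Phi_opp //; apply/admissible_opp.
Qed.

Lemma coupling_triple_int (R : realType) (h : R) (M : curl_modes h)
    (k m n : wavenumber) :
  admissible n -> coupling M (k, m, n) = 'i * triple_int M k m (- n).
Proof.
move=> an; congr (_ * _); apply: eq_cintegral => p /cell_closed hp.
by rewrite Phi_opp.
Qed.

Definition isolated_resonance (R : realType) (h : R) (M : curl_modes h)
    (T : triad) : Prop :=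
  [/\ sigma_invariant (Kstar (lam M)), single_resonance (Kstar (lam M)) T &
      [/\ idx2 T.1.1 != 0, idx2 T.1.2 != 0 & idx2 T.2 != 0]].

Lemma orbit_Kstar (R : realType) (h : R) (M : curl_modes h) (T : triad)
    (b1 b2 b3 : bool) :
  isolated_resonance M T -> Kstar (lam M) (on_triad (sigma b1 b2 b3) T).
Proof. by case=> KI [KT _] _; apply: sigma_invariant_sigma. Qed.

Lemma waves_orbit_disjoint (R : realType) (h : R) (M : curl_modes h) (T : triad)
    (v : wavenumber) (b2 b3 c2 c3 : bool) :
  isolated_resonance M T ->
  v \in map (flip b2 b3) (waves T) -> v \in map (flip c2 c3) (waves T) ->
  b2 = c2 /\ b3 = c3.
Proof.
case: T => [[x y] n] [_ [/Kstar_waves[[[_ ax] [_ ay] [_ an]] _ e2 e3] _] [x2 y2 n2]].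
by apply: flip_orbit_disjoint e2 e3; split=> //=; rewrite oppr_eq0.
Qed.

Lemma waves_mode (T : triad) (v : wavenumber) : v \in waves T -> mode v = v.
Proof. by rewrite !inE => /or3P[] /eqP ->; rewrite mode_id. Qed.

(** Uniqueness of the resonance puts the triad of [p] and [a] in the orbit of [T]; positive radial
    indices make [p.1] and [p.2] their own modes. *)
Lemma Kstar_orbit (R : realType) (h : R) (M : curl_modes h) (T : triad)
    (p : wavenumber * wavenumber) (a : wavenumber) :
  isolated_resonance M T -> inputs (Kstar (lam M)) a p ->
  exists b2 b3 : bool,
    perm_eq (map (flip b2 b3) (waves T)) [:: p.1; p.2; mode (- a)].
Proof.
case=> _ [_ KS] _ [Kp p1 p2]; have [b1 [b2 [b3]]] := KS _ Kp.
by rewrite waves_sigma /waves /= (mode_pos p1) (mode_pos p2); exists b2, b3.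
Qed.

(** The output wave determines the image of the triad that contains it, hence the two inputs up to
    order, and both orders resonate. For [x = y] the set is a singleton. *)
Lemma inputs_orbit (R : realType) (h : R) (M : curl_modes h) (T : triad)
    (x y a : wavenumber) (b2 b3 : bool) :
  isolated_resonance M T -> admissible a ->
  perm_eq (map (flip b2 b3) (waves T)) [:: x; y; mode (- a)] ->
  inputs (Kstar (lam M)) a = [set` [fset (x, y); (y, x)]%fset].
Proof.
move=> TI aa pe.
have xm : mode x = x.
  apply: (@waves_mode (on_triad (flip b2 b3) T)).
  by rewrite waves_sigma (perm_mem pe) mem_head.
have ym : mode y = y.
  apply: (@waves_mode (on_triad (flip b2 b3) T)).
  by rewrite waves_sigma (perm_mem pe) !inE eqxx orbT.
have Kxy : Kstar (lam M) (x, y, a).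
  apply: Kstar_perm (orbit_Kstar false b2 b3 TI).
  by rewrite waves_sigma (permPl pe) /waves /= xm ym.
have Kyx : Kstar (lam M) (y, x, a).
  apply: Kstar_perm Kxy; rewrite /waves /=.
  rewrite -[X in perm_eq X]/([:: _; _] ++ [:: _]).
  rewrite -[X in perm_eq _ X]/([:: _; _] ++ [:: _]).
  by rewrite perm_cat2r (perm_catC [:: _]).
have pos v : mode v = v -> admissible v -> 0 < idx1 v.
  by move=> vm [v1 _]; rewrite -vm lt_neqAle eq_sym /= normr_eq0 v1 normr_ge0.
have [[ax ay _] _ _ _ _] := Kxy.
apply/seteqP; split=> [p pin|p]; last first.
  by rewrite /= !inE => /orP[] /eqP ->; split=> //; apply: pos.
have [c2 [c3 pe']] := Kstar_orbit TI pin.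
(* The wave [mode (- a)] lies in both images, which forces equal flips. *)
have [bc2 bc3] : b2 = c2 /\ b3 = c3.
  apply: (waves_orbit_disjoint (v := mode (- a)) TI);
    by rewrite (perm_mem pe, perm_mem pe') !inE eqxx !orbT.
have : perm_eq ([:: p.1; p.2] ++ [:: mode (- a)]) ([:: x; y] ++ [:: mode (- a)]).
  by rewrite /= -(permPl pe') -bc2 -bc3.
rewrite perm_cat2r => /perm_eq2; case: p {pin pe'} => p1 p2 /=.
by rewrite !inE => -[] ->; rewrite eqxx ?orbT.
Qed.

Lemma inputs_off_orbit (R : realType) (h : R) (M : curl_modes h) (T : triad)
    (a : wavenumber) :
  isolated_resonance M T ->
  (forall b2 b3, mode (- a) \notin map (flip b2 b3) (waves T)) ->
  inputs (Kstar (lam M)) a = [set` fset0].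
Proof.
move=> TI aT; apply/seteqP; split=> p //= pin.
have [b2 [b3 pe]] := Kstar_orbit TI pin.
by have := aT b2 b3; rewrite (perm_mem pe) !inE eqxx !orbT.
Qed.

(** * Euler equations as equations of three interacting waves *)

Definition euler_at (R : realType) (h : R) (M : curl_modes h) (J : set R)
    (u : wavenumber -> R -> R[i]) (n : wavenumber) : Prop :=
  forall t, J t ->
    exists2 S : R[i],
      has_sum (inputs (Kstar (lam M)) n)
        (fun p => (lam M p.1)%:C
                  * inner h (fun y => cross (Phi M p.1 y) (Phi M p.2 y))
                      (Phi M n)
                  * (u p.1 t * u p.2 t)) S
      & is_cderive (u n) t (- S).

(* The equation of the mode - z driven by x and y, for three waves that add up
   to zero; up to conjugation all equations of the rigid body systems have this
   form. *)
Definition wave_eq (R : realType) (h : R) (M : curl_modes h) (J : set R)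
    (U : wavenumber -> R -> R[i]) (x y z : wavenumber) : Prop :=
  forall t, J t ->
    is_cderive (U (- z)) t
      ((lam M x - lam M y)%:C * triple_int M x y z * (U x t * U y t)).

Lemma real_amplitudesN (R : realType) (J : set R) (u : wavenumber -> R -> R[i]) :
  real_amplitudes J u -> real_amplitudes J (fun a t => - u a t).
Proof. by move=> ru a aa t Jt; have [-> ->] := ru a aa t Jt; rewrite rmorphN. Qed.

Lemma amplitude_mode (R : realType) (J : set R) (U : wavenumber -> R -> R[i])
    (x : wavenumber) (t : R) :
  real_amplitudes J U -> admissible x -> J t -> U (mode x) t = U x t.
Proof.
case: x => [[x1 x2] x3] rU ax Jt; rewrite /mode /=.
by case: (ger0P (idx1 (x1, x2, x3))) => _ //; have [<-] := rU _ ax t Jt.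
Qed.

Lemma amplitude_opp (R : realType) (J : set R) (U : wavenumber -> R -> R[i])
    (x : wavenumber) (t : R) :
  real_amplitudes J U -> admissible x -> J t -> U (- x) t = (U x t)^*.
Proof. by move=> rU ax Jt; have [_ ->] := rU _ ax t Jt. Qed.

Lemma wave_eq_mode (R : realType) (h : R) (M : curl_modes h) (J : set R)
    (U : wavenumber -> R -> R[i]) (x y z : wavenumber) :
  open J -> real_amplitudes J U ->
  admissible x -> admissible y -> admissible z ->
  wave_eq M J U (mode x) (mode y) (mode z) <-> wave_eq M J U x y z.
Proof.
move=> oJ rU ax ay az.
have zE t : J t -> U (- mode z) t = U (- z) t.
  move=> Jt; have az' := (admissible_mode z).2 az.
  by rewrite !(amplitude_opp rU) // (amplitude_mode rU).
by split=> eqU t Jt; have := eqU t Jt;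
  rewrite !lam_mode // triple_int_mode // !(amplitude_mode rU) //;
  apply: is_cderive_eq_on oJ Jt _ => s Js; rewrite zE.
Qed.

(** This is the complex conjugate equation: conjugation negates the indices of amplitudes and triple
    integral and fixes [lam]. *)
Lemma wave_eq_opp (R : realType) (h : R) (M : curl_modes h) (J : set R)
    (U : wavenumber -> R -> R[i]) (x y z : wavenumber) :
  open J -> real_amplitudes J U ->
  admissible x -> admissible y -> admissible z ->
  wave_eq M J U x y z -> wave_eq M J U (- x) (- y) (- z).
Proof.
move=> oJ rU ax ay az eqU t Jt.
rewrite !lam_opp // triple_int_opp // !(amplitude_opp rU) // -rmorphM.
have /is_cderive_conj := eqU t Jt; rewrite !rmorphM /= oppr0.
apply: is_cderive_eq_on oJ Jt _ => s Js.
by rewrite (amplitude_opp rU) ?conjcK ?opprK.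
Qed.

(** The inputs [(x, y)] and [(y, x)] have opposite triple integrals, so their eigenvalue factors
    combine into a difference. Passing from [u] to [- u] keeps the quadratic term and reverses the
    derivative, which removes the minus sign. *)
Lemma euler_at_orbit (R : realType) (h : R) (M : curl_modes h) (T : triad)
    (J : set R) (u : wavenumber -> R -> R[i]) (x y a : wavenumber)
    (b2 b3 : bool) :
  isolated_resonance M T -> open J -> real_amplitudes J u -> admissible a ->
  perm_eq (map (flip b2 b3) (waves T)) [:: x; y; mode (- a)] ->
  euler_at M J u a <-> wave_eq M J (fun v t => - u v t) x y (mode (- a)).
Proof.
move=> TI oJ ru aa pe.
have uE t : J t -> u (- mode (- a)) t = u a t.
  move=> Jt; have aa' := (admissible_opp a).2 aa.
  rewrite (amplitude_opp ru) ?(amplitude_mode ru) // ?(amplitude_opp ru) ?conjcK //.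
  exact/admissible_mode.
pose S t := (lam M x - lam M y)%:C * triple_int M x y (mode (- a)) * (u x t * u y t).
have sumE t (s : R[i]) :
    has_sum (inputs (Kstar (lam M)) a)
      (fun p => (lam M p.1)%:C
                * inner h (fun y => cross (Phi M p.1 y) (Phi M p.2 y)) (Phi M a)
                * (u p.1 t * u p.2 t)) s <-> s = S t.
  rewrite (inputs_orbit TI aa pe) has_sum_fset.
  suff -> : \sum_(p <- [fset (x, y); (y, x)]%fset) ((lam M p.1)%:C
      * inner h (fun y => cross (Phi M p.1 y) (Phi M p.2 y)) (Phi M a)
      * (u p.1 t * u p.2 t)) = S t by [].
  (* For [x = y] the two ordered pairs merge into one term, which vanishes by alternation, as does
     [S t]. *)
  have [xy|xy] := eqVneq x y.
    rewrite /S xy fsetUid big_seq_fset1 /= inner_cross // triple_int_diag.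
    by rewrite !(mulr0, mul0r).
  rewrite big_fsetU1 ?big_seq_fset1 /=; last by rewrite inE xpair_eqE (negPf xy).
  rewrite !inner_cross // (triple_int_swap _ x y) /S rmorphB /=; ring.
split=> [eu t Jt|eu t Jt].
  have [s /sumE -> /is_cderiveN] := eu t Jt; rewrite mulrNN opprK.
  by apply: is_cderive_eq_on oJ Jt _ => r Jr; rewrite uE.
exists (S t); first exact/sumE.
have := eu t Jt; rewrite mulrNN => /is_cderiveN.
by apply: is_cderive_eq_on oJ Jt _ => r Jr; rewrite opprK uE.
Qed.

Lemma euler_at_off_orbit (R : realType) (h : R) (M : curl_modes h) (T : triad)
    (J : set R) (u : wavenumber -> R -> R[i]) (a : wavenumber) :
  isolated_resonance M T ->
  (forall b2 b3, mode (- a) \notin map (flip b2 b3) (waves T)) ->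
  euler_at M J u a <-> (forall t, J t -> is_cderive (fun s => - u a s) t 0).
Proof.
move=> TI aT; rewrite /euler_at (inputs_off_orbit TI aT).
split=> [eu t Jt|eu t Jt].
  have [s /has_sum_fset ->] := eu t Jt; rewrite big_seq_fset0 => /is_cderiveN.
  by rewrite !oppr0.
exists 0; first by apply/has_sum_fset; rewrite big_seq_fset0.
have /is_cderiveN := eu t Jt.
by under [in X in X -> _]eq_fun do rewrite opprK.
Qed.

(** * Product rule and quadratic invariants *)

Lemma is_cderive_cst (R : realType) (c : R[i]) (t : R) :
  is_cderive (fun=> c) t 0.
Proof. by split; exact: is_derive_cst. Qed.

Lemma is_cderiveD (R : realType) (f g : R -> R[i]) (t : R) (v w : R[i]) :
  is_cderive f t v -> is_cderive g t w -> is_cderive (fun s => f s + g s) t (v + w).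
Proof.
move=> [fr fi] [gr gi].
have ReD (x y : R[i]) : complex.Re (x + y) = complex.Re x + complex.Re y.
  by case: x y => [? ?] [].
have ImD (x y : R[i]) : complex.Im (x + y) = complex.Im x + complex.Im y.
  by case: x y => [? ?] [].
split.
  rewrite ReD (_ : (fun s => _) =
      (fun s => complex.Re (f s)) + (fun s => complex.Re (g s))).
    exact: is_deriveD.
  by apply/funext => s; rewrite ReD.
rewrite ImD (_ : (fun s => _) =
    (fun s => complex.Im (f s)) + (fun s => complex.Im (g s))).
  exact: is_deriveD.
by apply/funext => s; rewrite ImD.
Qed.

Lemma is_cderiveM (R : realType) (f g : R -> R[i]) (t : R) (v w : R[i]) :
  is_cderive f t v -> is_cderive g t w ->
  is_cderive (fun s => f s * g s) t (v * g t + f t * w).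
Proof.
move=> [fr fi] [gr gi]; split.
  rewrite (_ : (fun s => _) =
      (fun s => complex.Re (f s)) * (fun s => complex.Re (g s))
      - (fun s => complex.Im (f s)) * (fun s => complex.Im (g s))).
    apply: is_derive_eq; rewrite /GRing.scale /=.
    by case: (f t) (g t) v w {fr fi gr gi} => [? ?] [? ?] [? ?] [? ?] /=; ring.
  by apply/funext => s; rewrite !fctE; case: (f s) (g s) => [? ?] [].
rewrite (_ : (fun s => _) =
    (fun s => complex.Re (f s)) * (fun s => complex.Im (g s))
    + (fun s => complex.Im (f s)) * (fun s => complex.Re (g s))).
  apply: is_derive_eq; rewrite /GRing.scale /=.
  by case: (f t) (g t) v w {fr fi gr gi} => [? ?] [? ?] [? ?] [? ?] /=; ring.
by apply/funext => s; rewrite !fctE; case: (f s) (g s) => [? ?] [].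
Qed.

(** General weights cover both energy (all equal to 1) and helicity (the eigenvalues). For real [C]
    the three derivatives are multiples of one cubic expression, and the condition on the weights
    makes these multiples cancel. *)
Lemma rigid_body_conserved (R : realType) (lk lm ln wk wm wn : R) (C : R[i])
    (J : set R) (Uk Um Un : R -> R[i]) (t : R) :
  complex.Im C = 0 ->
  wk * (lm - ln) + wm * (ln - lk) + wn * (lk - lm) = 0 ->
  rigid_body lk lm ln C J Uk Um Un -> J t ->
  is_cderive (fun s => wk%:C * (Uk s * (Uk s)^*) + wm%:C * (Um s * (Um s)^*)
                       + wn%:C * (Un s * (Un s)^*)) t 0.
Proof.
case: C => c c' /= -> w0 rb Jt; have [dn dk dm] := rb t Jt.
have sq (w : R) (f : R -> R[i]) (v : R[i]) : is_cderive f t v ->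
    is_cderive (fun s => w%:C * (f s * (f s)^*)) t
      (w%:C * (v * (f t)^* + f t * v^*)).
  move=> df; have := is_cderiveM (is_cderive_cst w%:C t)
    (is_cderiveM df (is_cderive_conj df)).
  by rewrite mul0r add0r.
have := is_cderiveD (is_cderiveD (sq wk _ _ dk) (sq wm _ _ dm)) (sq wn _ _ dn).
congr is_cderive.
case: (Uk t) (Um t) (Un t) => [k1 k2] [m1 m2] [n1 n2].
apply: complex_eq => /=; last by ring.
(* The second factor is twice [c] times the imaginary part of [Uk t * Um t] multiplied by the
   conjugate of [Un t]. *)
transitivity ((wk * (lm - ln) + wm * (ln - lk) + wn * (lk - lm))
  * (2 * c * (k1 * m2 * n1 + k2 * m1 * n1 - k1 * m1 * n2 + k2 * m2 * n2))).
  ring.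
by rewrite w0 mul0r.
Qed.

(** * Rigid body systems in terms of waves *)

Lemma Im_coupling (R : realType) (h : R) (M : curl_modes h) (T : triad) :
  phase_normalized M -> Kstar (lam M) T -> complex.Im (coupling M T) = 0.
Proof.
case: T => [[k m] n] MP [[ak am an] _ _ e3 e2]; rewrite coupling_triple_int //.
have : complex.Re (triple_int M k m (- n)) = 0.
  apply: Re_triple_int => //; first exact/admissible_opp.
    by rewrite -[idx2 (- n)]/(- idx2 n) e2 subrr.
  by rewrite -[idx3 (- n)]/(- idx3 n) e3 subrr.
by case: (triple_int _ _ _ _) => a b /= ->; rewrite mul0r mul1r addr0.
Qed.

(** The last two wave equations govern [U (- k)] and [U (- m)], so they are the conjugates of the
    equations of [U k] and [U m]. Conjugation reverses the imaginary triple integral, whence the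
    opposite sign in these two rigid body equations. *)
Lemma rigid_body_wave_eq (R : realType) (h : R) (M : curl_modes h)
    (k m n : wavenumber) (J : set R) (U : wavenumber -> R -> R[i]) :
  phase_normalized M -> Kstar (lam M) (k, m, n) ->
  open J -> real_amplitudes J U ->
  rigid_body_of M (k, m, n) J (U k) (U m) (U n) <->
  [/\ wave_eq M J U k m (- n), wave_eq M J U m (- n) k & wave_eq M J U (- n) k m].
Proof.
move=> MP KT oJ rU; have [[ak am an] _ _ e3 e2] := KT.
have an' := (admissible_opp n).2 an.
have D0 : complex.Re (triple_int M k m (- n)) = 0.
  apply: Re_triple_int => //.
    by rewrite -[idx2 (- n)]/(- idx2 n) e2 subrr.
  by rewrite -[idx3 (- n)]/(- idx3 n) e3 subrr.
have Uopp v s : admissible v -> J s -> U (- v) s = (U v s)^*.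
  by move=> av; apply: amplitude_opp rU av.
rewrite /rigid_body_of /rigid_body coupling_triple_int // /wave_eq.
rewrite -[(k, m, n).1.1]/k -[(k, m, n).1.2]/m -[(k, m, n).2]/n.
rewrite opprK lam_opp // (triple_int_cyclic M k m (- n)).
rewrite (triple_int_cyclic M m (- n) k) (triple_int_cyclic M k m (- n)).
move: (triple_int M k m (- n)) D0 => [? d] /= ->.
have eqn t : - ('i * (lam M k - lam M m)%:C * ('i * (0 +i* d)) * U k t * U m t)
    = (lam M k - lam M m)%:C * (0 +i* d) * (U k t * U m t).
  by case: (U k t) (U m t) => [? ?] [? ?]; apply: complex_eq => /=; ring.
have eqk t : J t -> 'i * (lam M m - lam M n)%:C * ('i * (0 +i* d)) * U n t * (U m t)^*
    = ((lam M m - lam M n)%:C * (0 +i* d) * (U m t * U (- n) t))^*.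
  by move=> Jt; rewrite Uopp //; case: (U n t) (U m t) => [? ?] [? ?];
    apply: complex_eq => /=; ring.
have eqm t : J t -> 'i * (lam M n - lam M k)%:C * ('i * (0 +i* d)) * U n t * (U k t)^*
    = ((lam M n - lam M k)%:C * (0 +i* d) * (U (- n) t * U k t))^*.
  by move=> Jt; rewrite Uopp //; case: (U n t) (U k t) => [? ?] [? ?];
    apply: complex_eq => /=; ring.
have cj v t w : admissible v -> J t ->
    is_cderive (U (- v)) t w <-> is_cderive (U v) t w^*.
  by move=> av Jt; apply: is_cderive_conj_on oJ Jt _ => s Js; rewrite Uopp ?conjcK.
split=> [rb|[wn wk wm] t Jt].
  by split=> t Jt; have [dn dk dm] := rb t Jt;
    rewrite -?eqn //; apply/cj; rewrite // -?eqk -?eqm.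
by rewrite eqn eqk // eqm //; split; [exact: wn| |];
  apply/cj => //; [exact: wk|exact: wm].
Qed.

(** * Modes outside the orbit and uncoupling of the systems *)

Lemma idx2_neq0 (x : wavenumber) : sigma2 x <> x -> idx2 x != 0.
Proof.
move=> sx; apply/eqP => x20; apply: sx.
by rewrite /sigma2 x20 oppr0 -x20; case: x {x20} => [[]].
Qed.

Lemma flip_opp (b2 b3 : bool) (x y : wavenumber) :
  flip true true x = flip b2 b3 y <-> x = flip (~~ b2) (~~ b3) y.
Proof.
split=> [xy|->]; first by rewrite -[LHS](flipK true true) xy flipM.
by rewrite flipM !addTb !negbK.
Qed.

(** Negating a mode flips both of its last indices. Inputs therefore reappear with complemented
    flips, while for the output, listed in [waves] with opposite sign, the two negations cancel. *)
Lemma off_orbit (T : triad) (a : wavenumber) :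
  (forall b1 b2 b3, mode a \notin modes (on_triad (sigma b1 b2 b3) T)) <->
  (forall b2 b3, mode (- a) \notin map (flip b2 b3) (waves T)).
Proof.
rewrite /waves !mode_opp; split=> aT.
  move=> b2 b3; apply/negP; rewrite !inE => /or3P[] /eqP.
  - move=> /flip_opp e; have := aT false (~~ b2) (~~ b3).
    by rewrite modes_sigma !inE e eqxx.
  - move=> /flip_opp e; have := aT false (~~ b2) (~~ b3).
    by rewrite modes_sigma !inE e eqxx orbT.
  rewrite flipM !addbT => /flip_opp; rewrite !negbK => e.
  by have := aT false b2 b3; rewrite modes_sigma !inE e eqxx !orbT.
have opp c2 c3 x : mode a = flip c2 c3 x ->
    flip true true (mode a) = flip (~~ c2) (~~ c3) x.
  by move=> e; apply/flip_opp; rewrite !negbK.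
move=> b1 b2 b3; apply/negP; rewrite modes_sigma !inE => /or3P[] /eqP /opp e.
- by have := aT (~~ b2) (~~ b3); rewrite !inE e eqxx.
- by have := aT (~~ b2) (~~ b3); rewrite !inE e eqxx orbT.
by have := aT b2 b3; rewrite !inE flipM !addbT e eqxx !orbT.
Qed.

Lemma coupling_eq0 (R : realType) (h : R) (M : curl_modes h) (k m n : wavenumber) :
  admissible k -> admissible m -> admissible n ->
  mode k = mode (- n) \/ mode m = mode (- n) -> coupling M (k, m, n) = 0.
Proof.
move=> ak am an kmn; have an' := (admissible_opp n).2 an.
rewrite coupling_triple_int // -triple_int_mode //.
case: kmn => ->; last by rewrite -triple_int_cyclic triple_int_diag mulr0.
by rewrite -triple_int_cyclic -triple_int_cyclic triple_int_diag mulr0.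
Qed.

(* A mode shared by two of the systems must be an input of one and the output
   of the other, which forces two of the three waves k, m, - n to coincide. *)
Lemma uncoupled_orbit (R : realType) (h : R) (M : curl_modes h) (T : triad)
    (b2 b3 c2 c3 : bool) :
  isolated_resonance M T -> (b2, b3) != (c2, c3) ->
  uncoupled M (on_triad (flip b2 b3) T) (on_triad (flip c2 c3) T).
Proof.
case: T => [[k m] n] TI bc.
have [kmn|kmn] := boolP ((mode k == mode (- n)) || (mode m == mode (- n))).
  have c0 d2 d3 : coupling M (on_triad (flip d2 d3) (k, m, n)) = 0.
    have [[? ? ?] _ _ _ _] := orbit_Kstar false d2 d3 TI.
    apply: coupling_eq0 => //; rewrite -sigma_opp !mode_sigma.
    by case/orP: kmn => /eqP ->; [left|right].
  by right; rewrite !c0.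
left; apply/negP => /hasP[v]; rewrite !modes_sigma => vc vb.
have disj d2 d3 e2 e3 p q : p \in waves (k, m, n) -> q \in waves (k, m, n) ->
    flip d2 d3 p = flip e2 e3 q -> d2 = e2 /\ d3 = e3.
  move=> pw qw pq; apply: (waves_orbit_disjoint (v := flip d2 d3 p) TI).
    exact: map_f.
  by rewrite pq map_f.
have [wk wm wn] : [/\ mode k \in waves (k, m, n), mode m \in waves (k, m, n)
    & mode (- n) \in waves (k, m, n)].
  by rewrite !inE !eqxx !orbT.
have nE : mode n = flip true true (mode (- n)) by rewrite mode_opp flipK.
(* An output is a flip of [mode (- n)] with both bits complemented; disjointness would identify [p]
   with [mode (- n)]. *)
have inout d2 d3 e2 e3 p : p \in waves (k, m, n) -> p != mode (- n) ->
    flip d2 d3 p <> flip e2 e3 (mode n).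
  move=> pw /eqP pn; rewrite nE flipM => e; apply: pn.
  have [d2E d3E] := disj _ _ _ _ _ _ pw wn e.
  by apply: (can_inj (flipK d2 d3)); rewrite e d2E d3E.
have eqbc : b2 = c2 /\ b3 = c3 -> False by case=> e2 e3; rewrite e2 e3 eqxx in bc.
move: kmn; rewrite negb_or => /andP[kn mn].
(* Two inputs or two outputs in common force equal flips, against [bc]; an input meeting an output
   is excluded by [inout]. *)
move: vb vc; rewrite !inE => /or3P[] /eqP -> /or3P[] /eqP e.
all: try by apply: eqbc; apply: disj e.
all: try by apply: inout e.
all: try by apply: inout (esym e).
by apply: eqbc; move: e; rewrite nE !flipM => /disj[] // /addIb -> /addIb ->.
Qed.

(** * The Euler system on the images of the triad *)

Lemma Kstar_opp (R : realType) (h : R) (M : curl_modes h) (k m n : wavenumber) :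
  Kstar (lam M) (k, m, n) ->
  [/\ admissible k, admissible m & admissible (- n)].
Proof. by case=> [[? ? ?] _ _ _ _]; split=> //; apply/admissible_opp. Qed.

Definition wave_system (R : realType) (h : R) (M : curl_modes h) (J : set R)
    (U : wavenumber -> R -> R[i]) (w : seq wavenumber) : Prop :=
  let x := w`_0 in let y := w`_1 in let z := w`_2 in
  [/\ wave_eq M J U x y z, wave_eq M J U y z x & wave_eq M J U z x y].

Lemma rigid_body_wave_system (R : realType) (h : R) (M : curl_modes h)
    (T : triad) (J : set R) (U : wavenumber -> R -> R[i]) (b2 b3 : bool) :
  phase_normalized M -> isolated_resonance M T ->
  open J -> real_amplitudes J U ->
  rigid_body_of M (on_triad (flip b2 b3) T) J (U (flip b2 b3 T.1.1))
    (U (flip b2 b3 T.1.2)) (U (flip b2 b3 T.2)) <->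
  wave_system M J U (map (flip b2 b3) (waves T)).
Proof.
case: T => [[k m] n] MP TI oJ rU.
have KT := orbit_Kstar false b2 b3 TI.
have [ak am an] := Kstar_opp KT.
rewrite rigid_body_wave_eq //.
have eq1 := wave_eq_mode M oJ rU ak am an.
have eq2 := wave_eq_mode M oJ rU am an ak.
have eq3 := wave_eq_mode M oJ rU an ak am.
rewrite -(waves_sigma false).
by split=> -[e1 e2 e3]; (split; [exact/eq1|exact/eq2|exact/eq3]).
Qed.

(** Flipping both last indices is negation up to [sigma1], so each equation of the fourth image is
    the conjugate of one for the triad itself. *)
Lemma wave_system_opp (R : realType) (h : R) (M : curl_modes h)
    (T : triad) (J : set R) (U : wavenumber -> R -> R[i]) :
  isolated_resonance M T -> open J -> real_amplitudes J U ->
  wave_system M J U (map (flip false false) (waves T)) ->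
  wave_system M J U (map (flip true true) (waves T)).
Proof.
case: T => [[k m] n] TI oJ rU.
have [ak am an] := Kstar_opp (orbit_Kstar false false false TI).
have [/admissible_mode mk /admissible_mode mm /admissible_mode mn] := And3 ak am an.
have mE v : flip true true (mode v) = mode (- mode v).
  by rewrite mode_opp mode_id.
have step x y z : admissible x -> admissible y -> admissible z ->
    wave_eq M J U (mode x) (mode y) (mode z) ->
    wave_eq M J U (mode (- mode x)) (mode (- mode y)) (mode (- mode z)).
  move=> /admissible_mode ax /admissible_mode ay /admissible_mode az.
  move=> /wave_eq_opp H; apply/wave_eq_mode => //; try exact/admissible_opp.
  exact: H.
rewrite /wave_system /= !mE => -[e1 e2 e3].
by split; apply: step.
Qed.

Lemma waves_admissible (R : realType) (h : R) (M : curl_modes h) (T : triad)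
    (v : wavenumber) :
  Kstar (lam M) T -> v \in waves T -> admissible v.
Proof.
case: T => [[k m] n] /Kstar_opp[ak am an].
by rewrite !inE => /or3P[] /eqP ->; apply/admissible_mode.
Qed.

(** Each wave of the image is [mode (- a)] for some [a], with the other two as inputs; the three
    choices give the three cyclic equations. *)
Lemma euler_at_wave_system (R : realType) (h : R) (M : curl_modes h) (T : triad)
    (J : set R) (u : wavenumber -> R -> R[i]) (b2 b3 : bool) :
  isolated_resonance M T -> open J -> real_amplitudes J u ->
  (forall a, admissible a -> mode (- a) \in map (flip b2 b3) (waves T) ->
     euler_at M J u a) <->
  wave_system M J (fun v t => - u v t) (map (flip b2 b3) (waves T)).
Proof.
move=> TI oJ ru; have eul a x y := @euler_at_orbit R h M T J u x y a b2 b3 TI oJ ru.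
have KT := orbit_Kstar false b2 b3 TI.
have wv v : v \in map (flip b2 b3) (waves T) -> mode v = v /\ admissible v.
  by rewrite -(waves_sigma false) => vw; split;
    [exact: waves_mode vw|exact: waves_admissible KT vw].
move: eul wv; rewrite /wave_system; set w := map _ _.
have : w = [:: w`_0; w`_1; w`_2] by [].
move: (w`_0) (w`_1) (w`_2) => x y z -> eul wv.
have pyzx : perm_eq [:: x; y; z] [:: y; z; x] by rewrite -(perm_rot 1).
have pzxy : perm_eq [:: x; y; z] [:: z; x; y] by rewrite -(perm_rot 2).
split=> [eu|[e1 e2 e3] a aa]; last first.
  rewrite !inE => /or3P[] /eqP az.
  - by apply/(eul a y z aa); rewrite az.
  - by apply/(eul a z x aa); rewrite az.
  - by apply/(eul a x y aa); rewrite az.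
have step v v' v'' : perm_eq [:: x; y; z] [:: v; v'; v''] ->
    wave_eq M J (fun v t => - u v t) v v' v''.
  move=> pe; have vw : v'' \in [:: x; y; z] by rewrite (perm_mem pe) !inE eqxx !orbT.
  have [vm /admissible_opp av] := wv _ vw.
  rewrite -[v'']vm -[v'']opprK; apply/eul => //; rewrite ?opprK ?vm //.
  by apply: eu => //; rewrite opprK vm.
by split; apply: step.
Qed.

Theorem theorem3p4 (R : realType) (h : R) (M : curl_modes h)
    (k m n : wavenumber)
    (h_gt0 : 0 < h)
    (M_phase : phase_normalized M)
    (K_sym : sigma_invariant (Kstar (lam M)))
    (K_single : single_resonance (Kstar (lam M)) (k, m, n))
    (k_sigma : sigma2 k <> k /\ sigma3 k <> k)
    (m_sigma : sigma2 m <> m /\ sigma3 m <> m)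
    (n_sigma : sigma2 n <> n /\ sigma3 n <> n) :
  let T1 : triad := (k, m, n) in
  let T2 : triad := on_triad sigma2 T1 in
  let T3 : triad := on_triad sigma3 T1 in
  [/\ (* the coupling coefficients are real *)
      [/\ complex.Im (coupling M T1) = 0, complex.Im (coupling M T2) = 0
        & complex.Im (coupling M T3) = 0],
      (* the strictly resonant system reduces to the three systems, all other
         amplitudes being constant *)
      forall (J : set R) (u : wavenumber -> R -> R[i]),
        open J -> real_amplitudes J u ->
        let U (a : wavenumber) (t : R) := - u a t in
        resonant_euler M J u <->
        [/\ rigid_body_of M T1 J (U k) (U m) (U n),
            rigid_body_of M T2 J (U (sigma2 k)) (U (sigma2 m)) (U (sigma2 n)),
            rigid_body_of M T3 J (U (sigma3 k)) (U (sigma3 m)) (U (sigma3 n))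
          & forall a, admissible a ->
              (forall b1 b2 b3 : bool,
                 mode a \notin modes (on_triad (sigma b1 b2 b3) T1)) ->
              forall t, J t -> is_cderive (U a) t 0],
      (* the three systems are mutually uncoupled *)
      [/\ uncoupled M T1 T2, uncoupled M T1 T3 & uncoupled M T2 T3]
    & (* energy and helicity conservation for each system *)
      forall T : triad, T \in [:: T1; T2; T3] ->
      forall (J : set R) (Uk Um Un : R -> R[i]),
        rigid_body_of M T J Uk Um Un ->
        forall t, J t ->
          is_cderive (fun s => Uk s * (Uk s)^* + Um s * (Um s)^*
                               + Un s * (Un s)^*) t 0 /\
          is_cderive (fun s => (lam M T.1.1)%:C * (Uk s * (Uk s)^*)
                               + (lam M T.1.2)%:C * (Um s * (Um s)^*)
                               + (lam M T.2)%:C * (Un s * (Un s)^*)) t 0].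
Proof.
move=> T1 T2 T3.
have TI : isolated_resonance M T1.
  by split=> //; split; apply: idx2_neq0; [case: k_sigma|case: m_sigma|case: n_sigma].
have K1 := orbit_Kstar false false false TI.
have K2 := orbit_Kstar false true false TI.
have K3 := orbit_Kstar false false true TI.
split.
- by split; apply: Im_coupling.
- move=> J u oJ ru U; have rU : real_amplitudes J U := real_amplitudesN ru.
  have sys b2 b3 := rigid_body_wave_system b2 b3 M_phase TI oJ rU.
  have eul b2 b3 := euler_at_wave_system b2 b3 TI oJ ru.
  split=> [eu|[/(sys false false) s00 /(sys true false) s10
      /(sys false true) s01 off]].
    have wsys b2 b3 : wave_system M J U (map (flip b2 b3) (waves T1)).
      by apply/eul => a aa _; apply: eu.
    split; [exact/(sys false false)|exact/(sys true false)|exact/(sys false true)|].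
    move=> a aa /off_orbit aT; exact/(euler_at_off_orbit _ _ TI aT)/eu.
  (* The statement lists three of the four images; conjugation supplies the fourth. *)
  have s11 := wave_system_opp TI oJ rU s00.
  move=> a aa; rewrite -/(euler_at M J u a).
  (* A mode is either driven within one of the four images or has no resonant input. *)
  have [[b2 [b3 ab]]|aT] := pselect (exists b2 b3 : bool,
      mode (- a) \in map (flip b2 b3) (waves T1)).
    by move: a aa ab; apply/eul; case: b2 b3 => [] [].
  have aT' b2 b3 : mode (- a) \notin map (flip b2 b3) (waves T1).
    by apply/negP => ab; apply: aT; exists b2, b3.
  by apply/(euler_at_off_orbit _ _ TI aT'); apply: off => //; apply/off_orbit.
- split; [exact: (@uncoupled_orbit R h M T1 false false true false TI isT)
    |exact: (@uncoupled_orbit R h M T1 false false false true TI isT)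
    |exact: (@uncoupled_orbit R h M T1 true false false true TI isT)].
move=> T Tin J Uk Um Un rb t Jt.
have C0 : complex.Im (coupling M T) = 0.
  by move: Tin; rewrite !inE => /or3P[] /eqP ->; apply: Im_coupling.
(* Helicity takes the eigenvalues as weights, energy unit weights; both cyclic sums vanish
   identically. *)
split; last by apply: (rigid_body_conserved C0 _ rb Jt); ring.
have := rigid_body_conserved (wk := 1) (wm := 1) (wn := 1) C0 _ rb Jt.
rewrite (_ : (fun s => _) = (fun s => Uk s * (Uk s)^* + Um s * (Um s)^* + Un s * (Un s)^*)).
  by apply; ring.
by apply/funext => s; rewrite !mul1r.
Qed.
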